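(* Let $X$ be a paracompact space, $\mathscr{K}^\bullet$ a complex of fine sheaves on $X$, $X'\subset X$ an open set, and $V_1\subset X$ an arbitrary open set containing $X\smallsetminus X'$. Put $V_0=X'$, $V_1^\star=X$, $V_{01}=V_0\cap V_1$, $\mathcal{V}=\{V_0,V_1\}$, $\mathcal{V}^\star=\{V_0,V_1^\star\}$, $\mathcal{V}'=\{V_0\}$. Then the restriction $\mathscr{K}^{\bullet}(\mathcal{V}^{\star},\mathcal{V}')\to\mathscr{K}^{\bullet}(\mathcal{V},\mathcal{V}')$, $(\xi_1,\xi_{01})\mapsto(\xi_1|_{V_1},\xi_{01}|_{V_{01}})$, induces an isomorphism $$H^{q}_{D_{\mathscr{K}}}(X,X')\overset{\sim}{\longrightarrow}H^{q}_{D_{\mathscr{K}}}(\mathcal{V},\mathcal{V}')$$ for every $q$.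
   Context: Sheaves are sheaves of abelian groups; complexes of sheaves $(\mathscr{K}^\bullet,d)$ vanish in negative degrees. Paracompact means Hausdorff and every open covering admits a locally finite refinement. A sheaf $\mathscr{G}$ on a paracompact space is soft if its global sections restrict surjectively onto sections over every closed subset; it is fine if $\mathscr{H}om(\mathscr{G},\mathscr{G})$ is soft. $\mathscr{K}^\bullet(\mathcal{V},\mathcal{V}')$ is the complex with $\mathscr{K}^q(\mathcal{V},\mathcal{V}')=\mathscr{K}^q(V_1)\oplus\mathscr{K}^{q-1}(V_{01})$ and $D(\xi_1,\xi_{01})=(d\xi_1,\ \xi_1|_{V_{01}}-d\xi_{01})$; its cohomology is $H^q_{D_{\mathscr{K}}}(\mathcal{V},\mathcal{V}')$. $\mathscr{K}^\bullet(\mathcal{V}^\star,\mathcal{V}')$ is the same complex with $V_1$ replaced by $V_1^\star=X$, so $\mathscr{K}^q(\mathcal{V}^\star,\mathcal{V}')=\mathscr{K}^q(X)\oplus\mathscr{K}^{q-1}(X')$; its cohomology is denoted $H^q_{D_{\mathscr{K}}}(X,X')$. *)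

(* Defs.v *)
From HB Require Import structures.
From mathcomp Require Import all_boot all_order all_algebra.
From mathcomp Require Import all_classical topology.

Set Implicit Arguments.
Unset Strict Implicit.
Unset Printing Implicit Defensive.

Import GRing.Theory.

Local Open Scope classical_set_scope.
Local Open Scope ring_scope.
Local Open Scope quotient_scope.

Definition paracompact (X : topologicalType) : Prop :=
  hausdorff_space X /\
  forall C : set (set X),
    (forall A, C A -> open A) -> \bigcup_(A in C) A = setT ->
    exists D : set (set X),
      [/\ forall B, D B -> open B,
          \bigcup_(B in D) B = setT,
          forall B, D B -> exists2 A, C A & B `<=` A
        & forall x : X, exists2 N, nbhs x N &
            finite_set [set B | D B /\ B `&` N !=set0]].

Record opens (X : topologicalType) := Opens {
  oset :> set X;
  open_oset : open oset
}.
Arguments Opens {X}.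

Definition opensT (X : topologicalType) : opens X := Opens setT openT.

Definition opensI (X : topologicalType) (U V : opens X) : opens X :=
  Opens (U `&` V) (openI (open_oset U) (open_oset V)).

Lemma opens_inj (X : topologicalType) (U V : opens X) :
  oset U = oset V -> U = V.
Proof.
case: U V => [U oU] [V oV] /= eUV; subst V.
by rewrite (Prop_irrelevance oU oV).
Qed.

(** * Sheaves of abelian groups *)

Record presheaf (X : topologicalType) := Presheaf {
  sec :> opens X -> zmodType;
  res : forall U V : opens X, V `<=` U -> {additive sec U -> sec V};
  res_id : forall (U : opens X) (UU : U `<=` U) (s : sec U), res UU s = s;
  res_comp : forall (U V W : opens X) (VU : V `<=` U) (WV : W `<=` V)
      (WU : W `<=` U) (s : sec U), res WV (res VU s) = res WU s
}.
Arguments res {X} p {U V}.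

Definition is_sheaf (X : topologicalType) (F : presheaf X) : Prop :=
  forall (I : Type) (U : opens X) (V : I -> opens X)
      (VU : forall i, V i `<=` U), U `<=` \bigcup_i V i ->
    (forall s t : F U, (forall i, res F (VU i) s = res F (VU i) t) -> s = t) /\
    (forall s : forall i, F (V i),
       (forall i j,
          res F (@subIsetl _ (V i) (V j) : opensI (V i) (V j) `<=` V i) (s i) =
          res F (@subIsetr _ (V i) (V j) : opensI (V i) (V j) `<=` V j) (s j)) ->
       exists t : F U, forall i, res F (VU i) t = s i).

Record sheaf (X : topologicalType) := Sheaf {
  sheaf_presheaf :> presheaf X;
  sheafP : is_sheaf sheaf_presheaf
}.

Record sheaf_mor (X : topologicalType) (F G : sheaf X) := SheafMor {
  smor :> forall U : opens X, {additive F U -> G U};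
  smor_nat : forall (U V : opens X) (VU : V `<=` U) (s : F U),
    smor V (res F VU s) = res G VU (smor U s)
}.

(** * The sheaf [Hom(F, G)] *)

(* A section over [U] is a morphism from [F] restricted to [U] to [G]
   restricted to [U]; the opens of the subspace [U] are the opens of [X]
   contained in [U]. *)
Record hom_sec (X : topologicalType) (F G : presheaf X) (U : opens X) := HomSec {
  hom_fun :> forall V : opens X, V `<=` U -> F V -> G V;
  hom_zmod : forall (V : opens X) (VU : V `<=` U), zmod_morphism (hom_fun VU);
  hom_nat : forall (V W : opens X) (VU : V `<=` U) (WU : W `<=` U)
      (WV : W `<=` V) (s : F V),
    hom_fun WU (res F WV s) = res G WV (hom_fun VU s)
}.

Section HomGroup.
Context (X : topologicalType) (F G : presheaf X) (U : opens X).
Implicit Types f g h : hom_sec F G U.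

Lemma hom_secP f g :
  (forall (V : opens X) (VU : V `<=` U) s, f V VU s = g V VU s) -> f = g.
Proof.
case: f g => [f fD fn] [g gD gn] /= fg.
have {}fg : f = g.
  by do 3 (apply: functional_extensionality_dep => ?); exact: fg.
subst g.
by rewrite (Prop_irrelevance fD gD) (Prop_irrelevance fn gn).
Qed.

HB.instance Definition _ := gen_eqMixin (hom_sec F G U).
HB.instance Definition _ := gen_choiceMixin (hom_sec F G U).

Program Definition hom_zero : hom_sec F G U :=
  @HomSec X F G U (fun _ _ _ => 0) _ _.
Next Obligation. by move=> V VU s t; rewrite subr0. Qed.
Next Obligation. by move=> V W VU WU WV s; rewrite raddf0. Qed.

Program Definition hom_opp f : hom_sec F G U :=
  @HomSec X F G U (fun V VU s => - f V VU s) _ _.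
Next Obligation. by move=> f V VU s t; rewrite (hom_zmod f VU) opprB opprK addrC. Qed.
Next Obligation.
by move=> f V W VU WU WV s; rewrite raddfN (hom_nat f VU WU).
Qed.

Program Definition hom_add f g : hom_sec F G U :=
  @HomSec X F G U (fun V VU s => f V VU s + g V VU s) _ _.
Next Obligation.
by move=> f g V VU s t; rewrite (hom_zmod f VU) (hom_zmod g VU) opprD addrACA.
Qed.
Next Obligation.
by move=> f g V W VU WU WV s; rewrite raddfD (hom_nat f VU WU) (hom_nat g VU WU).
Qed.

Lemma hom_addA : associative hom_add.
Proof. by move=> f g h; apply: hom_secP => V VU s /=; rewrite addrA. Qed.
Lemma hom_addC : commutative hom_add.
Proof. by move=> f g; apply: hom_secP => V VU s /=; rewrite addrC. Qed.
Lemma hom_add0 : left_id hom_zero hom_add.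
Proof. by move=> f; apply: hom_secP => V VU s /=; rewrite add0r. Qed.
Lemma hom_addN : left_inverse hom_zero hom_opp hom_add.
Proof. by move=> f; apply: hom_secP => V VU s /=; rewrite addNr. Qed.

HB.instance Definition _ := GRing.isZmodule.Build (hom_sec F G U)
  hom_addA hom_addC hom_add0 hom_addN.

End HomGroup.

Section HomSheaf.
Context (X : topologicalType).

Program Definition hom_restr (F G : presheaf X) (U V : opens X)
    (VU : V `<=` U) (f : hom_sec F G U) : hom_sec F G V :=
  @HomSec X F G V (fun W WV => f W (subset_trans WV VU)) _ _.
Next Obligation. by move=> F G U V VU f W WV; exact: hom_zmod. Qed.
Next Obligation. by move=> F G U V VU f W W' ? ? ? s; exact: hom_nat. Qed.

Lemma hom_restr_zmod (F G : presheaf X) (U V : opens X) (VU : V `<=` U) :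
  zmod_morphism (@hom_restr F G U V VU).
Proof. by move=> f g; apply: hom_secP. Qed.

HB.instance Definition _ (F G : presheaf X) (U V : opens X) (VU : V `<=` U) :=
  GRing.isZmodMorphism.Build (hom_sec F G U) (hom_sec F G V)
    (hom_restr VU) (hom_restr_zmod VU).

Program Definition hom_presheaf (F G : presheaf X) : presheaf X :=
  @Presheaf X (fun U => hom_sec F G U : zmodType)
    (fun U V VU => @hom_restr F G U V VU) _ _.
Next Obligation.
move=> F G U UU f; apply: hom_secP => V VU s /=.
by rewrite (Prop_irrelevance (subset_trans _ _) VU).
Qed.
Next Obligation.
move=> F G U V W VU WV WU f; apply: hom_secP => Z ZW s /=.
by congr (hom_fun f _ s); exact: Prop_irrelevance.
Qed.

Lemma hom_irr (F G : presheaf X) (U V : opens X) (f : hom_sec F G U)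
  (VU VU' : V `<=` U) s : f V VU s = f V VU' s.
Proof. by rewrite (Prop_irrelevance VU VU'). Qed.

Lemma hom_is_sheaf (F : presheaf X) (G : sheaf X) :
  is_sheaf (hom_presheaf F G).
Proof.
move=> I U V VU UV.
have covI (W : opens X) : W `<=` U -> W `<=` \bigcup_i opensI W (V i).
  by move=> WU x Wx; have [i _ Vx] := UV x (WU x Wx); exists i.
have IW (W : opens X) i : opensI W (V i) `<=` W by exact: subIsetl.
have IV (W : opens X) i : opensI W (V i) `<=` V i by exact: subIsetr.
split.
- move=> f g fg; apply: hom_secP => W WU s.
  have [+ _] := @sheafP X G I W (fun i => opensI W (V i)) (IW W) (covI W WU).
  apply=> i; have WiU : opensI W (V i) `<=` U := subset_trans (IW W i) WU.
  rewrite -(hom_nat f WU WiU) -(hom_nat g WU WiU).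
  have := congr1 (fun h : hom_sec F G (V i) =>
     h (opensI W (V i)) (IV W i) (res F (IW W i) s)) (fg i).
  by move=> /=; rewrite (hom_irr f _ WiU) (hom_irr g _ WiU).
- move=> f fcomp.
  have fE i j (Z : opens X) (Zi : Z `<=` V i) (Zj : Z `<=` V j) t :
      f i Z Zi t = f j Z Zj t.
    have Zij : Z `<=` opensI (V i) (V j) by move=> x Zx; split; [exact: Zi|exact: Zj].
    have := congr1 (fun h : hom_sec F G (opensI (V i) (V j)) => h Z Zij t) (fcomp i j).
    by move=> /=; rewrite (hom_irr (f i) _ Zi) (hom_irr (f j) _ Zj).
  have ex (W : opens X) (WU : W `<=` U) (s : F W) : exists t : G W, forall i,
      res G (IW W i) t = f i (opensI W (V i)) (IV W i) (res F (IW W i) s).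
    have [_] := @sheafP X G I W (fun i => opensI W (V i)) (IW W) (covI W WU).
    apply=> i j.
    set Z := opensI _ _.
    have Zi : Z `<=` V i by move=> x [[]].
    have Zj : Z `<=` V j by move=> x [_ []].
    have ZW : Z `<=` W by move=> x [[]].
    rewrite -(hom_nat (f i) (IV W i) Zi) -(hom_nat (f j) (IV W j) Zj).
    by rewrite !(res_comp _ _ ZW); exact: fE.
  have uniqG (W : opens X) (WU : W `<=` U) (t t' : G W) :
      (forall i, res G (IW W i) t = res G (IW W i) t') -> t = t'.
    by have [+ _] := @sheafP X G I W (fun i => opensI W (V i)) (IW W) (covI W WU); apply.
  pose phi (W : opens X) (WU : W `<=` U) (s : F W) : G W := projT1 (cid (ex W WU s)).
  have phiE (W : opens X) (WU : W `<=` U) (s : F W) i :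
      res G (IW W i) (phi W WU s) = f i (opensI W (V i)) (IV W i) (res F (IW W i) s).
    by rewrite /phi; case: (cid _).
  have phiD (W : opens X) (WU : W `<=` U) : zmod_morphism (phi W WU).
    move=> s t; apply: (uniqG W WU) => i.
    by rewrite raddfB !phiE raddfB (hom_zmod (f i)).
  have phin (W Z : opens X) (WU : W `<=` U) (ZU : Z `<=` U) (ZW : Z `<=` W) (s : F W) :
      phi Z ZU (res F ZW s) = res G ZW (phi W WU s).
    apply: (uniqG Z ZU) => i.
    have ZiWi : opensI Z (V i) `<=` opensI W (V i).
      by move=> x [Zx Vx]; split => //; exact: ZW.
    have ZiW : opensI Z (V i) `<=` W := subset_trans (IW Z i) ZW.
    rewrite phiE (res_comp _ _ ZiW) (res_comp _ _ ZiW).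
    rewrite -(res_comp (IW W i) ZiWi) -[in RHS](res_comp (IW W i) ZiWi) phiE.
    by rewrite -(hom_nat (f i) (IV W i) (IV Z i)).
  exists (HomSec phiD phin) => i; apply: hom_secP => W WV s /=.
  apply: (uniqG W (subset_trans WV (VU i))) => j; rewrite phiE.
  have Wi : opensI W (V j) `<=` V i := subset_trans (IW W j) WV.
  by rewrite -(hom_nat (f i) WV Wi); exact: fE.
Qed.

Definition sheaf_hom (F G : sheaf X) : sheaf X := Sheaf (@hom_is_sheaf F G).

End HomSheaf.

(** * Stalks, sections over arbitrary subsets, soft and fine sheaves *)

Record local_sec (X : topologicalType) (F : presheaf X) (x : X) := LocalSec {
  ldom : opens X;
  ldomP : oset ldom x;
  lsec : F ldom
}.

Section Stalk.
Context (X : topologicalType) (F : presheaf X) (x : X).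

HB.instance Definition _ := gen_eqMixin (local_sec F x).
HB.instance Definition _ := gen_choiceMixin (local_sec F x).

Definition same_germ (s t : local_sec F x) : bool :=
  `[< exists (W : opens X) (Ws : W `<=` ldom s) (Wt : W `<=` ldom t),
        oset W x /\ res F Ws (lsec s) = res F Wt (lsec t) >].

Lemma same_germ_equiv : equiv_class_of same_germ.
Proof.
split=> [s|s t|t s u].
- by apply/asboolP; exists (ldom s), (@subset_refl _ _), (@subset_refl _ _); split=> //; exact: ldomP.
- by apply/asboolP/asboolP => -[W [W1 [W2 [Wx e]]]]; exists W, W2, W1.
- move=> /asboolP[W [W1 [W2 [Wx e]]]] /asboolP[W' [W1' [W2' [Wx' e']]]].
  apply/asboolP; exists (opensI W W').
  have IW : opensI W W' `<=` W by exact: subIsetl.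
  have IW' : opensI W W' `<=` W' by exact: subIsetr.
  exists (subset_trans IW W1), (subset_trans IW' W2'); split => //.
  rewrite -(res_comp W1 IW) e -(res_comp W2' IW') -e'.
  by rewrite (res_comp _ _ (subset_trans IW W2)) (res_comp _ _ (subset_trans IW W2)).
Qed.

Canonical same_germ_equivRel := EquivRelPack same_germ_equiv.
Canonical same_germ_encModRel := defaultEncModRel same_germ.

Definition stalk := {eq_quot same_germ}.

Definition germ (U : opens X) (Ux : oset U x) (s : F U) : stalk :=
  \pi_stalk (LocalSec Ux s).

End Stalk.

(* Sections over [S] of the restriction (inverse image) of [F] to [S]: families
   of germs at the points of [S] locally induced by sections of [F]. *)
Definition is_section_on (X : topologicalType) (F : presheaf X) (S : set X)
    (s : forall x, S x -> stalk F x) : Prop :=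
  forall x, S x -> exists (U : opens X) (t : F U), oset U x /\
    forall y (Sy : S y) (Uy : oset U y), s y Sy = germ Uy t.

Definition soft (X : topologicalType) (F : sheaf X) : Prop :=
  forall (S : set X) (s : forall x, S x -> stalk F x),
    closed S -> is_section_on s ->
    exists t : F (opensT X), forall y (Sy : S y), s y Sy = germ (I : oset (opensT X) y) t.

Definition fine (X : topologicalType) (F : sheaf X) : Prop :=
  soft (sheaf_hom F F).

(** * Cochain complexes of abelian groups and their cohomology *)

(* Complexes vanishing in negative degrees are indexed by [nat]. *)
Record cochain := Cochain {
  cobj :> nat -> zmodType;
  cdiff : forall q, {additive cobj q -> cobj q.+1};
  cdiff_cdiff : forall q (x : cobj q), cdiff q.+1 (cdiff q x) = 0
}.

Arguments cdiff {_} q.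

Record cochain_map (C D : cochain) := CochainMap {
  cmap :> forall q, {additive C q -> D q};
  cmap_diff : forall q (x : C q), cmap q.+1 (cdiff q x) = cdiff q (cmap q x)
}.

Definition is_coboundary (C : cochain) (q : nat) : C q -> Prop :=
  match q return C q -> Prop with
  | 0%N => fun x => x = 0
  | p.+1 => fun x => exists y : C p, x = cdiff p y
  end.

Section Cohomology.
Context (C : cochain) (q : nat).

Definition is_cocycle : pred (C q) := fun x => cdiff q x == 0.

Lemma is_cocycle_closed : zmod_closed is_cocycle.
Proof.
split=> [|x y]; rewrite !unfold_in ?raddf0 // => /eqP x0 /eqP y0.
by rewrite raddfB x0 y0 subrr.
Qed.

HB.instance Definition _ := GRing.isZmodClosed.Build (C q) is_cocycle
  is_cocycle_closed.

Record cocycle := Cocycle { cocycle_val : C q; _ : is_cocycle cocycle_val }.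

HB.instance Definition _ := [isSub for cocycle_val].
HB.instance Definition _ := [Choice of cocycle by <:].
HB.instance Definition _ := [SubChoice_isSubZmodule of cocycle by <:].

Definition coboundary : pred cocycle :=
  fun z => `[< is_coboundary (cocycle_val z) >].

Lemma coboundary_closed : zmod_closed coboundary.
Proof.
have aux : is_coboundary (0 : C q) /\
    forall x y : C q, is_coboundary x -> is_coboundary y -> is_coboundary (x - y).
  case: (q) => [|p] /=.
    by split=> // x y -> ->; rewrite subr0.
  split; first by exists 0; rewrite raddf0.
  by move=> _ _ [x ->] [y ->]; exists (x - y); rewrite raddfB.
split=> [|x y]; first by apply/asboolP; exact: aux.1.
by move=> /asboolP bx /asboolP yb; apply/asboolP; exact: aux.2.
Qed.

HB.instance Definition _ := GRing.isZmodClosed.Build cocycle coboundary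
  coboundary_closed.

Definition cohomology : zmodType := Quotient.quot (GRing.ZmodClosed.clone cocycle coboundary _).

Definition coclass (z : cocycle) : cohomology := \pi_cohomology z.

End Cohomology.

Section CohomologyMap.
Context (C D : cochain) (f : cochain_map C D) (q : nat).

Lemma cmap_cocycle (z : cocycle C q) : is_cocycle (f q (cocycle_val z)).
Proof.
by case: z => z /= /eqP z0; rewrite /is_cocycle -cmap_diff z0 raddf0.
Qed.

Definition cocycle_map (z : cocycle C q) : cocycle D q :=
  Cocycle (cmap_cocycle z).

Definition cohomology_map (a : cohomology C q) : cohomology D q :=
  coclass (cocycle_map (repr a)).

End CohomologyMap.

Lemma cmap_coboundary (C D : cochain) (f : cochain_map C D) q (x : C q) :
  is_coboundary x -> is_coboundary (f q x).
Proof.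
case: q x => [|q] x /= => [->|[y ->]]; first by rewrite raddf0.
by exists (f q y); rewrite cmap_diff.
Qed.

(* [cohomology_map] does not depend on the choice of representatives. *)
Lemma cohomology_mapE (C D : cochain) (f : cochain_map C D) q (z : cocycle C q) :
  cohomology_map f (coclass z) = coclass (cocycle_map f z).
Proof.
apply/eqP; rewrite /cohomology_map /coclass -Quotient.idealrBE.
have : repr (\pi_(cohomology C q) z) - z \in @coboundary C q.
  by rewrite Quotient.idealrBE reprK.
rewrite !unfold_in => /asboolP h; apply/asboolP.
by have := cmap_coboundary f h; rewrite /= raddfB.
Qed.

Lemma cohomology_map_zmod (C D : cochain) (f : cochain_map C D) q :
  zmod_morphism (@cohomology_map C D f q).
Proof.
move=> a b; rewrite -[a]reprK -[b]reprK.
rewrite -[in LHS]raddfB -!/(coclass _) !cohomology_mapE /coclass -raddfB.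
congr (\pi_(cohomology D q) _); apply: val_inj.
by rewrite /= !raddfB.
Qed.

HB.instance Definition _ (C D : cochain) (f : cochain_map C D) q :=
  GRing.isZmodMorphism.Build (cohomology C q) (cohomology D q)
    (@cohomology_map C D f q) (@cohomology_map_zmod C D f q).

(** * Complexes of sheaves and the complexes [K(V, V')] *)

Record sheaf_complex (X : topologicalType) := SheafComplex {
  scobj :> nat -> sheaf X;
  scdiff : forall q, sheaf_mor (scobj q) (scobj q.+1);
  scdiff_scdiff : forall q (U : opens X) (s : scobj q U),
    scdiff q.+1 U (scdiff q U s) = 0
}.

Section RelativeComplex.
Context (X : topologicalType) (K : sheaf_complex X).

(* K^(q-1)(W), which is the trivial group for q = 0. *)
Definition prev_sec (q : nat) (W : opens X) : zmodType :=
  if q is p.+1 then K p W else 'I_1.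

Definition prev_diff (q : nat) (W : opens X) : {additive prev_sec q W -> K q W} :=
  match q return {additive prev_sec q W -> K q W} with
  | 0%N => \0%R
  | p.+1 => scdiff K p W
  end.

Definition prev_res (q : nat) (W W' : opens X) (W'W : W' `<=` W) :
    {additive prev_sec q W -> prev_sec q W'} :=
  match q return {additive prev_sec q W -> prev_sec q W'} with
  | 0%N => \0%R
  | p.+1 => res (K p) W'W
  end.

Section Complex.
Context (U W : opens X) (WU : W `<=` U).

Definition rel_obj (q : nat) : zmodType := (K q U * prev_sec q W)%type.

Definition rel_diff (q : nat) (x : rel_obj q) : rel_obj q.+1 :=
  (scdiff K q U x.1, res (K q) WU x.1 - prev_diff q W x.2).

Lemma rel_diff_zmod q : zmod_morphism (@rel_diff q).
Proof.
move=> x y; rewrite /rel_diff /= !raddfB /=; congr pair.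
by rewrite [RHS]/= opprD !opprK addrACA.
Qed.

HB.instance Definition _ q := GRing.isZmodMorphism.Build
  (rel_obj q) (rel_obj q.+1) (@rel_diff q) (@rel_diff_zmod q).

Lemma rel_diff_diff q (x : rel_obj q) : rel_diff (rel_diff x) = 0.
Proof.
apply: injective_projections => /=; first exact: scdiff_scdiff.
rewrite raddfB -smor_nat subKr.
by case: q x => [|q] x /=; [rewrite raddf0|exact: scdiff_scdiff].
Qed.

(* For W included in U, the complex of the pairs (x_1, x_01) in
   K^q(U) + K^(q-1)(W), with D (x_1, x_01) = (d x_1, x_1|W - d x_01). *)
Definition rel_complex : cochain := @Cochain rel_obj (@rel_diff) rel_diff_diff.

End Complex.

Section Restriction.
Context (U W U' W' : opens X) (WU : W `<=` U) (W'U' : W' `<=` U').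
Context (U'U : U' `<=` U) (W'W : W' `<=` W).

Definition rel_res_fun (q : nat) (x : rel_complex WU q) : rel_complex W'U' q :=
  (res (K q) U'U x.1, prev_res q W'W x.2).

Lemma rel_res_zmod q : zmod_morphism (@rel_res_fun q).
Proof. by move=> x y; rewrite /rel_res_fun /= !raddfB. Qed.

HB.instance Definition _ q := GRing.isZmodMorphism.Build
  (rel_complex WU q) (rel_complex W'U' q) (@rel_res_fun q) (@rel_res_zmod q).

Lemma rel_res_diff q (x : rel_complex WU q) :
  rel_res_fun (cdiff q x) = cdiff q (rel_res_fun x).
Proof.
apply: injective_projections => /=; first by rewrite smor_nat.
have W'U : W' `<=` U := subset_trans W'W WU.
rewrite raddfB !(res_comp _ _ W'U); congr (_ - _).
by case: q x => [|q] x /=; [rewrite raddf0|rewrite smor_nat].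
Qed.

Definition rel_res : cochain_map (rel_complex WU) (rel_complex W'U') :=
  @CochainMap (rel_complex WU) (rel_complex W'U') (@rel_res_fun) rel_res_diff.

End Restriction.

(* K(V, V') for V = {V_0, V_1} and V' = {V_0}. *)
Definition cover_complex (V0 V1 : opens X) : cochain :=
  rel_complex (@subIsetr X V0 V1 : opensI V0 V1 `<=` V1).

(* K(V*, V') for V* = {X', X} and V' = {X'}, with K^(q-1)(X') in place of
   K^(q-1)(X' /\ X). *)
Definition pair_complex (X' : opens X) : cochain :=
  rel_complex (@subsetT X X' : X' `<=` opensT X).

Definition pair_to_cover (X' V1 : opens X) :
    cochain_map (pair_complex X') (cover_complex X' V1) :=
  rel_res (@subsetT X X' : X' `<=` opensT X)
    (@subIsetr X X' V1 : opensI X' V1 `<=` V1)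
    (@subsetT X V1 : V1 `<=` opensT X)
    (@subIsetl X X' V1 : opensI X' V1 `<=` X').

End RelativeComplex.

(* Main.v *)
Require Import Defs.
From HB Require Import structures.
From mathcomp Require Import all_boot all_order all_algebra.
From mathcomp Require Import all_classical topology.

Set Implicit Arguments.
Unset Strict Implicit.
Unset Printing Implicit Defensive.

Local Open Scope classical_set_scope.

(* Softness of [Hom(K^p, K^p)], applied to the disjoint closed sets [X \ X'] and
   [X \ V1], gives an endomorphism [h] of [K^p] that is the identity near the
   first and zero near the second.  Extending [h s] and [h s - s] by zero writes
   every [s] in [K^p(V01)] as a difference of sections over [X'] and [V1], i.e.
   the Mayer-Vietoris sequence
     [0 -> K(X) -> K(X') + K(V1) -> K(V01) -> 0]
   is exact; a diagram chase concludes. *)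

Import GRing.Theory.

Local Open Scope ring_scope.
Local Open Scope quotient_scope.

(** * Gluing over two open sets and extension by zero *)

Section Gluing.
Context (X : topologicalType).
Implicit Types (F : sheaf X) (U V W N : opens X).

Lemma res_irr (F : presheaf X) U V (VU VU' : V `<=` U) (s : F U) :
  res F VU s = res F VU' s.
Proof. by rewrite (Prop_irrelevance VU VU'). Qed.

Lemma sheaf_eq2 F U V W (VU : V `<=` U) (WU : W `<=` U) (s t : F U) :
  U `<=` V `|` W -> res F VU s = res F VU t -> res F WU s = res F WU t -> s = t.
Proof.
move=> UVW sV sW.
pose C (b : bool) := if b then V else W.
have CU b : C b `<=` U by case: b.
have UC : U `<=` \bigcup_b C b.
  by move=> x /UVW[Vx|Wx]; [exists true|exists false].
have [+ _] := @sheafP _ F bool U C CU UC.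
by apply=> -[]; [move: (CU true)|move: (CU false)] => CU';
  rewrite ?(Prop_irrelevance CU' VU) ?(Prop_irrelevance CU' WU).
Qed.

Lemma sheaf_glue2 F U V W (VU : V `<=` U) (WU : W `<=` U) (s : F V) (t : F W) :
    U `<=` V `|` W ->
    res F (@subIsetl _ V W : opensI V W `<=` V) s =
    res F (@subIsetr _ V W : opensI V W `<=` W) t ->
  exists2 u : F U, res F VU u = s & res F WU u = t.
Proof.
move=> UVW st.
pose C (b : bool) := if b then V else W.
have CU b : C b `<=` U by case: b.
have UC : U `<=` \bigcup_b C b.
  by move=> x /UVW[Vx|Wx]; [exists true|exists false].
pose f b : F (C b) := if b is true then s else t.
have [_ /(_ f)[]] := @sheafP _ F bool U C CU UC.
  move=> [] []; rewrite /f /C; first exact: res_irr; first exact: st.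
  (* The two overlaps have the same points but are different terms, so [st] is transported by
     restricting it along this inclusion. *)
  - have WV : opensI W V `<=` opensI V W by move=> x [].
    have /(congr1 (res F WV)) := st.
    rewrite (res_comp _ _ (@subIsetr _ W V : opensI W V `<=` V)).
    by rewrite (res_comp _ _ (@subIsetl _ W V : opensI W V `<=` W)) => ->.
  - exact: res_irr.
move=> u uE; exists u.
- by rewrite -[RHS](uE true); exact: res_irr.
- by rewrite -[RHS](uE false); exact: res_irr.
Qed.

(** Glue [s] with the zero section. Since [N] may leave [U], the zero section is taken over the
    intersection of [N] and [U]. *)
Lemma sheaf_extend0 F U W N (WU : W `<=` U) (s : F W) :
    U `<=` W `|` N ->
    res F (@subIsetl _ W N : opensI W N `<=` W) s = 0 ->
  exists u : F U, res F WU u = s.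
Proof.
move=> UWN s0.
have NU : opensI N U `<=` U by exact: subIsetr.
have [|| u us _] := @sheaf_glue2 F U W (opensI N U) WU NU s 0.
- by move=> x Ux; have [Wx|Nx] := UWN x Ux; [left|right].
- rewrite raddf0.
  have WN : opensI W (opensI N U) `<=` opensI W N by move=> x [Wx []].
  by rewrite -(res_comp (@subIsetl _ W N : opensI W N `<=` W) WN) s0 raddf0.
by exists u.
Qed.

Lemma germ_eqP (F : presheaf X) (x : X) U V (Ux : oset U x) (Vx : oset V x)
    (s : F U) (t : F V) :
  germ Ux s = germ Vx t -> exists (W : opens X) (WU : W `<=` U) (WV : W `<=` V),
    oset W x /\ res F WU s = res F WV t.
Proof. by move=> /eqmodP /asboolP. Qed.

Lemma germ0_nbhd F U (s : F U) (S : set X) :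
    (forall x, S x -> exists (W : opens X) (WU : W `<=` U),
       oset W x /\ res F WU s = 0) ->
  exists (N : opens X) (NU : N `<=` U), S `<=` N /\ res F NU s = 0.
Proof.
move=> s0.
pose I := {W : opens X | exists WU : W `<=` U, res F WU s = 0}.
pose N := \bigcup_(i : I) oset (sval i).
have oN : open N by apply: bigcup_open => i _; exact: open_oset.
have NU : Opens N oN `<=` U by move=> x [[W [WU _]] _ /= Wx]; exact: WU.
exists (Opens N oN), NU; split.
  move=> x /s0[W [WU [Wx sW]]].
  by exists (exist _ W (ex_intro _ WU sW)).
have iN (i : I) : sval i `<=` Opens N oN by move=> x ix; exists i.
have [+ _] := @sheafP _ F I (Opens N oN) (fun i => sval i) iN (fun x => id).
apply=> -[W [WU sW]]; rewrite raddf0.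
by rewrite (res_comp _ _ WU).
Qed.

End Gluing.

(** * Cutoff endomorphisms of a fine sheaf *)

Program Definition hom_id (X : topologicalType) (F : presheaf X) (U : opens X) :
  hom_sec F F U := @HomSec X F F U (fun _ _ s => s) _ _.
Next Obligation. by move=> X F U V VU s t. Qed.
Next Obligation. by move=> X F U V W VU WU WV s. Qed.

Section FineSheaf.
Context (X : topologicalType) (F : sheaf X) (hF : fine F).
Context (V0 V1 : opens X) (cover : ~` V0 `<=` V1).

Lemma fine_cutoff : exists (h : hom_sec F F (opensT X)) (N0 N1 : opens X),
  [/\ ~` V1 `<=` N0, ~` V0 `<=` N1,
      forall (W : opens X) (WT : W `<=` opensT X) s, W `<=` N0 -> h W WT s = 0
    & forall (W : opens X) (WT : W `<=` opensT X) s, W `<=` N1 -> h W WT s = s].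
Proof.
pose H := sheaf_hom F F.
pose e : H (opensT X) := hom_id F (opensT X).
pose S := ~` V0 `|` ~` V1.
have cS : closed S.
  by apply: closedU; apply: open_closedC; exact: open_oset.
(* A point of [S] inside [V0] lies outside [V1] and gets the zero germ; a point outside [V0] gets
   the germ of the identity. *)
pose s x (Sx : S x) : stalk H x :=
  germ (I : oset (opensT X) x) (if pselect (oset V0 x) is left _ then 0 else e).
have ls : is_section_on s.
  move=> x Sx; have [V0x|V0x] := pselect (oset V0 x).
    exists V0, 0; split=> // y Sy V0y; rewrite /s; case: pselect => // _.
    apply/eqmodP/asboolP; exists V0, (@subsetT _ _), (@subset_refl _ _).
    by split => //=; rewrite !raddf0.
  (* Points of [S] in [V1] lie outside [V0], so on this neighbourhood [s] is the identity germ
     throughout. *)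
  exists V1, (res H (@subsetT _ V1 : V1 `<=` opensT X) e).
  split=> [|y Sy V1y]; first exact: cover.
  rewrite /s; case: pselect => [V0y|_]; first by case: Sy.
  apply/eqmodP/asboolP; exists V1, (@subsetT _ _), (@subset_refl _ _).
  by split => //; rewrite [RHS]res_id.
have [h hs] := hF cS ls.
have [|N0 [N0T [VN0 h0]]] := @germ0_nbhd _ H (opensT X) h (~` V1).
  move=> x V1x; have Sx : S x by right.
  have V0x : oset V0 x by apply: contrapT => /cover.
  have := hs x Sx; rewrite /s; case: pselect => // _.
  move=> /esym/germ_eqP[W [WT [WT' [Wx hW]]]].
  by exists W, WT; split=> //; rewrite hW raddf0.
have [|N1 [N1T [VN1 h1]]] := @germ0_nbhd _ H (opensT X) (h - e) (~` V0).
  move=> x V0x; have Sx : S x by left.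
  have := hs x Sx; rewrite /s; case: pselect => // _.
  move=> /esym/germ_eqP[W [WT [WT' [Wx hW]]]].
  exists W, WT; split=> //.
  by rewrite raddfB hW (res_irr WT' WT) subrr.
exists h, N0, N1; split => // W WT t WN.
- have := congr1 (fun g : hom_sec F F N0 => g W WN t) h0.
  by rewrite /= (hom_irr _ _ WT).
- have := congr1 (fun g : hom_sec F F N1 => g W WN t) h1.
  by rewrite /= (hom_irr _ _ WT) => /eqP; rewrite subr_eq0 => /eqP.
Qed.

Lemma mayer_vietoris_surj (s : F (opensI V0 V1)) :
  exists (a : F V0) (b : F V1),
    s = res F (@subIsetl _ V0 V1 : opensI V0 V1 `<=` V0) a -
        res F (@subIsetr _ V0 V1 : opensI V0 V1 `<=` V1) b.
Proof.
have [h [N0 [N1 [VN0 VN1 h0 h1]]]] := fine_cutoff.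
have WT : opensI V0 V1 `<=` opensT X by exact: subsetT.
have [||a aE] := @sheaf_extend0 _ F V0 (opensI V0 V1) N0
    (@subIsetl _ V0 V1) (h _ WT s).
- by move=> x V0x; have [V1x|/VN0] := pselect (oset V1 x); [left|right].
(* Naturality moves the restriction inside [h], to an open set contained in [N0]. *)
- by rewrite -(hom_nat h WT (@subsetT _ _)) h0 // => x [].
have [||b bE] := @sheaf_extend0 _ F V1 (opensI V0 V1) N1
    (@subIsetr _ V0 V1) (h _ WT s - s).
- by move=> x V1x; have [V0x|/VN1] := pselect (oset V0 x); [left|right].
- by rewrite raddfB -(hom_nat h WT (@subsetT _ _)) h1 ?subrr // => x [].
by exists a, b; rewrite aE bE subKr.
Qed.

End FineSheaf.

(** * Bijectivity on cohomology, tested on cochains *)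

Lemma coclass_eq0 (C : cochain) (q : nat) (z : cocycle C q) :
  coclass z = 0 <-> is_coboundary (cocycle_val z).
Proof.
rewrite /coclass -[0](raddf0 \pi_(cohomology C q)); split.
  move=> /eqP; rewrite -Quotient.idealrBE subr0.
  by rewrite unfold_in => /asboolP.
by move=> zb; apply/eqP; rewrite -Quotient.idealrBE subr0 unfold_in; apply/asboolP.
Qed.

(** By additivity, injectivity is a statement about the kernel; surjectivity is checked on
    representatives, and choice then provides the inverse. *)
Lemma cohomology_map_bij (C D : cochain) (f : cochain_map C D) (q : nat) :
    (forall x : C q, cdiff q x = 0 -> is_coboundary (f q x) -> is_coboundary x) ->
    (forall y : D q, cdiff q y = 0 ->
       exists2 x : C q, cdiff q x = 0 & is_coboundary (f q x - y)) ->
  bijective (cohomology_map f (q := q)).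
Proof.
move=> finj fsurj.
have inj : injective (cohomology_map f (q := q)).
  apply: raddf_inj => a; have -> : a = coclass (repr a) by rewrite /coclass reprK.
  move: (repr a) => z /=; rewrite cohomology_mapE => /coclass_eq0 zb.
  by apply/coclass_eq0; apply: finj zb; case: z => z /= /eqP.
have surj b : exists a, cohomology_map f (q := q) a = b.
  rewrite -[b]reprK; case: (repr b) => y yc.
  have [|x /eqP xc xy] := fsurj y; first exact/eqP.
  exists (coclass (Cocycle xc : cocycle C q)); rewrite cohomology_mapE.
  by apply/eqP; rewrite /coclass -Quotient.idealrBE unfold_in; apply/asboolP.
exists (fun b => projT1 (cid (surj b))) => [a|b].
  by apply: inj; case: cid.
by case: cid.
Qed.

(** * The diagram chase *)

Section Excision.
Context (X : topologicalType) (K : sheaf_complex X).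
Context (hK : forall q, fine (K q)).
Context (X' V1 : opens X) (hV1 : ~` X' `<=` V1).

Let X'T : X' `<=` opensT X := @subsetT X X'.
Let V1T : V1 `<=` opensT X := @subsetT X V1.
Let IX' : opensI X' V1 `<=` X' := @subIsetl X X' V1.
Let IV1 : opensI X' V1 `<=` V1 := @subIsetr X X' V1.

Let TU : opensT X `<=` X' `|` V1.
Proof. by move=> x _; have [|/hV1] := pselect (oset X' x); [left|right]. Qed.

(** In degree zero the groups are trivial; above it this is Mayer-Vietoris surjectivity. *)
Lemma prev_surj q (s : prev_sec K q (opensI X' V1)) :
  exists (a : prev_sec K q X') (b : prev_sec K q V1),
    s = prev_res K q IX' a - prev_res K q IV1 b.
Proof.
case: q s => [|q] s; last exact: mayer_vietoris_surj.
by exists 0, 0; rewrite [LHS]ord1 [RHS]ord1.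
Qed.

Lemma prev_diff_nat q (U V : opens X) (VU : V `<=` U) (s : prev_sec K q U) :
  prev_diff K q V (prev_res K q VU s) = res (K q) VU (prev_diff K q U s).
Proof. by case: q s => [|q] s; [rewrite !raddf0|exact: smor_nat]. Qed.

Lemma diff_prev_diff q (U : opens X) (s : prev_sec K q U) :
  scdiff K q U (prev_diff K q U s) = 0.
Proof. by case: q s => [|q] s; [rewrite !raddf0|exact: scdiff_scdiff]. Qed.

(** If the image of [(xi, eta)] is [D (al, be)], split [be] as [b0 - b1] on the overlap. Then
    [eta + d b0] and [al + d b1] agree there and glue to [g], and [D (g, b0) = (xi, eta)]. *)
Lemma pair_coboundary q (x : pair_complex K X' q) :
  cdiff q x = 0 -> is_coboundary (pair_to_cover K X' V1 q x) -> is_coboundary x.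
Proof.
case: x => xi eta dx.
have {dx} [xi0 xiX'] := (congr1 fst dx, congr1 snd dx).
(* In degree zero a coboundary is zero: [xi] vanishes on [X'] by the cocycle condition and on [V1]
   by hypothesis. *)
case: q xi eta xi0 xiX' => [|q] xi eta /= xi0 /eqP.
  rewrite subr0 => /eqP xiX' /(congr1 fst) /= xiV1.
  congr pair; last by rewrite [LHS]ord1.
  by apply: (sheaf_eq2 TU); rewrite raddf0; [exact: xiX'|exact: xiV1].
rewrite subr_eq0 => /eqP xiX' [[al be] y].
have {y} [/= xiV1 etaI] := (congr1 fst y, congr1 snd y).
have [b0 [b1 beE]] := prev_surj be.
have [|g gX' gV1] := @sheaf_glue2 _ (K q) _ _ _ X'T V1T
  (eta + prev_diff K q X' b0) (al + prev_diff K q V1 b1) TU.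
  rewrite !raddfD -!prev_diff_nat etaI beE !raddfB /=.
  by rewrite opprK -addrA addrAC addNr add0r.
exists (g, b0); congr pair; last by rewrite gX' addrK.
apply: (sheaf_eq2 TU); rewrite -smor_nat.
  by rewrite gX' raddfD diff_prev_diff addr0.
by rewrite gV1 raddfD diff_prev_diff addr0.
Qed.

(** Split [eta] as [b0 - b1] on the overlap. The cocycle condition makes [d b0] and [xi + d b1]
    agree there; they glue to [g], and [(g, b0)] is a cocycle whose image differs from [(xi, eta)]
    by [D (b1, 0)]. *)
Lemma cover_cocycle_lift q (y : cover_complex K X' V1 q) : cdiff q y = 0 ->
  exists2 x : pair_complex K X' q, cdiff q x = 0 &
    is_coboundary (pair_to_cover K X' V1 q x - y).
Proof.
case: y => xi eta dy.
have {dy} [/= xi0 /eqP] := (congr1 fst dy, congr1 snd dy).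
rewrite subr_eq0 => /eqP xiI.
have [b0 [b1 etaE]] := prev_surj eta.
have [|g gX' gV1] := @sheaf_glue2 _ (K q) _ _ _ X'T V1T
  (prev_diff K q X' b0) (xi + prev_diff K q V1 b1) TU.
  by rewrite raddfD xiI -!prev_diff_nat etaE raddfB addrNK.
exists (g, b0).
  congr pair; last by rewrite /= gX' subrr.
  apply: (sheaf_eq2 TU); rewrite -smor_nat raddf0.
    by rewrite gX' diff_prev_diff.
  by rewrite gV1 raddfD /= xi0 diff_prev_diff addr0.
have -> : pair_to_cover K X' V1 q (g, b0) - (xi, eta) =
    (prev_diff K q V1 b1, prev_res K q IV1 b1) :> cover_complex K X' V1 q.
  congr pair => /=; first by rewrite gV1 addrC addKr.
  by rewrite etaE subKr.
(* In degree zero [b1] lies in a trivial group and the difference must be zero itself. *)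
case: (q) b1 {etaE gV1} => [|p] b1 /=; first by congr pair; rewrite [LHS]ord1.
by exists (b1, 0); congr pair; rewrite raddf0 subr0.
Qed.

End Excision.

Theorem proposition4p9 (X : topologicalType) (hX : paracompact X)
    (K : sheaf_complex X) (hK : forall q : nat, fine (K q))
    (X' V1 : opens X) (hV1 : ~` X' `<=` V1) (q : nat) :
  bijective (cohomology_map (pair_to_cover K X' V1) (q:=q)
    : {additive cohomology (pair_complex K X') q ->
                cohomology (cover_complex K X' V1) q}).
Proof.
apply: cohomology_map_bij => [x|y]; first exact: pair_coboundary.
exact: cover_cocycle_lift.
Qed.
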